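(* Let $n\ge2$, $\omega\in\mathbb{R}^n$ and $k\in\mathbb{R}_{>0}^n$ satisfy (IC1) $\sum_{\mu=1}^n\omega_\mu=0$, (IC2) $\omega\neq0$, and (IC3) $\left|\frac{\omega_1}{k_1}\right|\le\cdots\le\left|\frac{\omega_n}{k_n}\right|$. Then there are at most $2^n-2$ equilibria, i.e. at most $2^n-2$ points $\theta\in(-\pi,\pi]^n$ satisfying $$\omega_\nu=\frac1n\sum_{\mu=1}^n k_\nu k_\mu\sin(\theta_\nu-\theta_\mu)\quad(\nu=1,\ldots,n)\qquad\text{and}\qquad \sum_{\mu=1}^n k_\mu e^{i\theta_\mu}\in\mathbb{R}_{\ge0}.$$
   Context: The condition $\sum_\mu k_\mu e^{i\theta_\mu}\in\mathbb{R}_{\ge0}$ normalizes equilibria modulo a common shift of all angles (equilibria are counted modulo shift). *)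

(* Defs.v *)
From HB Require Import structures.
From mathcomp Require Import all_boot all_order all_algebra.
From mathcomp Require Import all_classical all_reals.
From mathcomp Require Import topology normedtype sequences exp trigo.
Set Implicit Arguments. Unset Strict Implicit. Unset Printing Implicit Defensive.
Import Order.TTheory GRing.Theory Num.Theory.
Local Open Scope ring_scope.

(* theta is an equilibrium (normalized modulo common shift) of the Kuramoto
   model with natural frequencies omega and coupling weights k:
   theta in (-pi, pi]^n,
   omega_nu = (1/n) sum_mu k_nu k_mu sin(theta_nu - theta_mu) for all nu,
   sum_mu k_mu e^{i theta_mu} in R_{>=0}, written out via real and
   imaginary parts: sum k_mu sin theta_mu = 0 and sum k_mu cos theta_mu >= 0. *)
Definition is_equilibrium (R : realType) (n : nat) (omega k : 'I_n -> R)
  (theta : {ffun 'I_n -> R}) : Prop :=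
  (forall mu : 'I_n, - pi < theta mu <= pi) /\
  (forall nu : 'I_n,
     omega nu = n%:R^-1 * \sum_(mu < n) k nu * k mu * sin (theta nu - theta mu)) /\
  (\sum_(mu < n) k mu * sin (theta mu) = 0) /\
  (0 <= \sum_(mu < n) k mu * cos (theta mu)).

(* Main.v *)
Require Import Defs.
From HB Require Import structures.
From mathcomp Require Import all_boot all_order all_algebra.
From mathcomp Require Import all_classical all_reals.
From mathcomp Require Import topology normedtype sequences exp trigo.
From mathcomp Require Import complex ring lra.
Set Implicit Arguments. Unset Strict Implicit. Unset Printing Implicit Defensive.
Import Order.TTheory GRing.Theory Num.Theory.
Local Open Scope ring_scope.

(* With r = (1/n) sum_i k_i cos theta_i the equilibrium equations become
   omega_i = k_i r sin theta_i, so with t = r^2 and a_i = (omega_i / k_i)^2 an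
   equilibrium amounts to t > 0 and signs sg_i with
     n t = sum_i sg_i k_i s_i,   s_i = sqrt (t - a_i).
   The product over all sign vectors of n t - sum_i sg_i k_i s_i is invariant
   under each s_i |-> - s_i, hence is a polynomial P(t); its degree is at most
   2^n. The equilibria with r^2 = t number at most the multiplicity of t as a
   root of P. At t = 0 one may take s_i = i omega_i / k_i, and sum_i omega_i = 0
   makes 0 a root of multiplicity at least 2 that is not an equilibrium. *)

(** * Eliminating square roots from sign-invariant polynomial expressions *)

Section RadicalPolynomials.
Variables (C : numFieldType) (n : nat) (a : 'I_n -> C).

Definition radicals (t : C) (s : 'I_n -> C) := forall i, s i ^+ 2 = t - a i.

Definition flip (V : zmodType) (i : 'I_n) (s : 'I_n -> V) : 'I_n -> V :=
  fun j => if j == i then - s j else s j.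

Lemma radicals_flip t s i : radicals t s -> radicals t (flip i s).
Proof. by move=> Hs j; rewrite /flip; case: eqP => _; rewrite ?sqrrN Hs. Qed.

(** Polynomials in [t] and the first [m] radicals, taken as functions; [m] is lowered one radical at
    a time, and [PolyfunExt] makes membership depend on values only. *)
Inductive polyfun (m : nat) : (C -> ('I_n -> C) -> C) -> Prop :=
| PolyfunConst c : polyfun m (fun _ _ => c)
| PolyfunVar : polyfun m (fun t _ => t)
| PolyfunRadical (i : 'I_n) of (i < m)%N : polyfun m (fun _ s => s i)
| PolyfunAdd g h of polyfun m g & polyfun m h :
    polyfun m (fun t s => g t s + h t s)
| PolyfunMul g h of polyfun m g & polyfun m h :
    polyfun m (fun t s => g t s * h t s)
| PolyfunExt g h of polyfun m g & (forall t s, g t s = h t s) : polyfun m h.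

Lemma polyfun_sum m (I : Type) (r : seq I) (g : I -> C -> ('I_n -> C) -> C) :
  (forall i, polyfun m (g i)) -> polyfun m (fun t s => \sum_(i <- r) g i t s).
Proof.
move=> Hg; elim: r => [|i r IH].
  by apply: PolyfunExt (PolyfunConst m 0) _ => t s; rewrite big_nil.
by apply: PolyfunExt (PolyfunAdd (Hg i) IH) _ => t s; rewrite big_cons.
Qed.

Lemma polyfun_prod m (I : Type) (r : seq I) (g : I -> C -> ('I_n -> C) -> C) :
  (forall i, polyfun m (g i)) -> polyfun m (fun t s => \prod_(i <- r) g i t s).
Proof.
move=> Hg; elim: r => [|i r IH].
  by apply: PolyfunExt (PolyfunConst m 1) _ => t s; rewrite big_nil.
by apply: PolyfunExt (PolyfunMul (Hg i) IH) _ => t s; rewrite big_cons.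
Qed.

Lemma polyfun_local m g t s s' : polyfun m g ->
  (forall i : 'I_n, (i < m)%N -> s i = s' i) -> g t s = g t s'.
Proof.
move=> Hg Hs; elim: {g} Hg => //=.
- by move=> g h _ -> _ ->.
- by move=> g h _ -> _ ->.
- by move=> g h _ IH E; rewrite -!E.
Qed.

(** Reduction modulo the relation defining [s i]: each square of [s i] becomes [t - a i], which
    leaves degree at most one in [s i]. *)
Lemma polyfun_split (i : 'I_n) g : polyfun i.+1 g ->
  exists g0 g1, [/\ polyfun i g0, polyfun i g1 &
    forall t s, radicals t s -> g t s = g0 t s + s i * g1 t s].
Proof.
elim=> {g}.
- move=> c; exists (fun _ _ => c), (fun _ _ => 0).
  by split; try exact: PolyfunConst; move=> t s _; rewrite mulr0 addr0.
- exists (fun t _ => t), (fun _ _ => 0).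
  by split; [exact: PolyfunVar|exact: PolyfunConst|move=> t s _; rewrite mulr0 addr0].
- move=> j; rewrite ltnS leq_eqVlt => /orP[/eqP/val_inj -> {j}|ji].
    exists (fun _ _ => 0), (fun _ _ => 1).
    by split; try exact: PolyfunConst; move=> t s _; rewrite mulr1 add0r.
  exists (fun _ s => s j), (fun _ _ => 0).
  by split; [exact: PolyfunRadical|exact: PolyfunConst|move=> t s _; rewrite mulr0 addr0].
- move=> g h _ [g0 [g1 [Hg0 Hg1 Eg]]] _ [h0 [h1 [Hh0 Hh1 Eh]]].
  exists (fun t s => g0 t s + h0 t s), (fun t s => g1 t s + h1 t s).
  split; try exact: PolyfunAdd.
  by move=> t s V; rewrite Eg // Eh // mulrDr addrACA.
- move=> g h _ [g0 [g1 [Hg0 Hg1 Eg]]] _ [h0 [h1 [Hh0 Hh1 Eh]]].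
  exists (fun t s => g0 t s * h0 t s + (t - a i) * (g1 t s * h1 t s)),
         (fun t s => g0 t s * h1 t s + g1 t s * h0 t s).
  split; first last.
  + by move=> t s V; rewrite Eg // Eh // -(V i); ring.
  + by apply: PolyfunAdd; apply: PolyfunMul.
  + do 2?[apply: PolyfunAdd || apply: PolyfunMul] => //; last exact: PolyfunMul.
    by apply: PolyfunAdd (PolyfunVar _) (PolyfunConst _ _).
- move=> g h _ [g0 [g1 [Hg0 Hg1 Eg]]] E; exists g0, g1; split=> // t s V.
  by rewrite -E Eg.
Qed.

Lemma polyfun0_poly g : polyfun 0 g -> exists P : {poly C}, forall t s, g t s = P.[t].
Proof.
elim=> {g} //.
- by move=> c; exists c%:P => t s; rewrite hornerC.
- by exists 'X => t s; rewrite hornerX.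
- by move=> g h _ [P HP] _ [Q HQ]; exists (P + Q) => t s; rewrite HP HQ hornerD.
- by move=> g h _ [P HP] _ [Q HQ]; exists (P * Q) => t s; rewrite HP HQ hornerM.
- by move=> g h _ [P HP] E; exists P => t s; rewrite -E.
Qed.

(* Writing g = g0 + s_i g1, invariance under s_i |-> - s_i kills the second
   term on the variety of radicals, so the radicals can be removed one by one. *)
Lemma flip_invariant_poly m g : (m <= n)%N -> polyfun m g ->
  (forall t s i, radicals t s -> g t (flip i s) = g t s) ->
  exists P : {poly C}, forall t s, radicals t s -> g t s = P.[t].
Proof.
elim: m g => [|m IH] g lemn Hg inv.
  by have [P HP] := polyfun0_poly Hg; exists P => t s _.
have [g0 [g1 [Hg0 Hg1 E]]] := @polyfun_split (Ordinal lemn) g Hg.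
set i := Ordinal lemn in Hg0 Hg1 E.
have Eg t s : radicals t s -> g t s = g0 t s.
  move=> V; have Vf := radicals_flip i V.
  have off : forall j : 'I_n, (j < i)%N -> flip i s j = s j.
    by move=> j ji; rewrite /flip; case: eqP ji => // ->; rewrite ltnn.
  have := inv t s i V; rewrite !E // (polyfun_local t Hg0 off) (polyfun_local t Hg1 off).
  rewrite {1}/flip eqxx mulNr => /addrI/eqP.
  by rewrite eq_sym -addr_eq0 -mulr2n mulrn_eq0 /= => /eqP ->; rewrite addr0.
have [|||P HP] := IH g0 => //; first exact: ltnW.
  by move=> t s j V; rewrite -!Eg ?inv //; exact: radicals_flip.
by exists P => t s V; rewrite Eg // HP.
Qed.

End RadicalPolynomials.

(** * Vanishing order and degree of a polynomial from size estimates *)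

Section Growth.
Variable C : numFieldType.

Lemma norm_horner_le (p : {poly C}) (r : C) : 0 <= r ->
  exists2 B, 0 <= B & forall x, `|x| <= r -> `|p.[x]| <= B.
Proof.
move=> r0; exists (\sum_(i < size p) `|p`_i| * r ^+ i).
  by apply: sumr_ge0 => i _; rewrite mulr_ge0 ?exprn_ge0.
move=> x xr; rewrite horner_coef (le_trans (ler_norm_sum _ _ _)) //.
apply: ler_sum => i _; rewrite normrM normrX ler_wpM2l //.
by rewrite lerXn2r // nnegrE.
Qed.

Lemma linear_bound_eq0 (x K : C) : 0 <= x -> 0 <= K ->
  (forall e, 0 < e -> e <= 1 -> x <= K * e) -> x = 0.
Proof.
move=> x0 K0 H; apply/eqP; apply: contraT => xn0.
have xp : 0 < x by rewrite lt_neqAle eq_sym xn0.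
have d0 : 0 < x + K + 1 by rewrite ltr_wpDl ?addr_ge0.
(* With this [e], the bound reads [x * (x + K + 1) <= K * x], impossible for [x > 0]. *)
have /H : 0 < x / (x + K + 1) by rewrite divr_gt0.
have -> : x / (x + K + 1) <= 1.
  by rewrite ler_pdivrMr // mul1r -addrA lerDl addr_ge0.
move=> /(_ isT); rewrite mulrA ler_pdivlMr // mulrDr mulrDr mulr1 (mulrC K x).
rewrite addrAC -lerBrDr subrr; have : 0 < x * x + x by rewrite addr_gt0 ?mulr_gt0.
by move=> /lt_le_trans h /h; rewrite ltxx.
Qed.

(** Decay along positive increments suffices: it forces [p.[x] = 0], and dividing by ['X - x%:P]
    lowers the exponent by one. *)
Lemma dvdp_XsubC_exp (N : nat) (p : {poly C}) (x K : C) : 0 <= K ->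
  (forall e, 0 < e -> e <= 1 -> `|p.[x + e]| <= K * e ^+ N) ->
  ('X - x%:P) ^+ N %| p.
Proof.
elim: N p => [|N IH] p K0 H; first by rewrite expr0 dvd1p.
have px0 : root p x.
  (* Shifting by [x] and factoring out ['X] gives [p.[x + e] = p.[x] + q'.[e] * e] with [q'] bounded
     on the unit disc, so [p.[x]] is O(e). *)
  pose q := p \Po ('X + x%:P) - p.[x]%:P.
  have /factor_theorem[q' Eq] : root q 0.
    by rewrite /root !hornerE horner_comp !hornerE subrr.
  have [B B0 HB] := norm_horner_le q' ler01.
  rewrite /root -normr_eq0; apply/eqP.
  apply: (@linear_bound_eq0 _ (K + B)); rewrite ?addr_ge0 // => e e0 e1.
  have -> : p.[x] = p.[x + e] - q'.[e] * e.
    have := congr1 (horner^~ e) Eq; rewrite /q !hornerE horner_comp !hornerE subr0.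
    by move=> <-; rewrite (addrC e x); ring.
  rewrite (le_trans (ler_normB _ _)) // mulrDl lerD //.
    rewrite (le_trans (H _ e0 e1)) // ler_wpM2l // exprS ler_piMr ?(ltW e0) //.
    by rewrite exprn_ile1 ?(ltW e0).
  by rewrite normrM (gtr0_norm e0) ler_wpM2r ?(ltW e0) // HB // gtr0_norm.
have /factor_theorem[q Eq] := px0.
rewrite Eq exprSr dvdp_mul2r ?polyXsubC_eq0 //; apply: IH => // e e0 e1.
have := H e e0 e1; rewrite Eq !hornerE addrAC subrr add0r normrM (gtr0_norm e0).
by rewrite exprSr mulrA ler_pM2r.
Qed.

Lemma size_poly_growth (d : nat) (p : {poly C}) (K : C) : 0 <= K ->
  (forall t, 1 <= t -> `|p.[t]| <= K * t ^+ d) -> (size p <= d.+1)%N.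
Proof.
move=> K0 H; rewrite leqNgt; apply/negP => lt_d.
have sp : (0 < size p)%N by apply: leq_trans lt_d.
set e := (size p).-2; have Ee : size p = e.+2.
  by rewrite /e; case: (size p) lt_d => [|[]].
have led : (d <= e)%N by move: lt_d; rewrite Ee.
have lp : 0 < `|lead_coef p|.
  by rewrite normr_gt0 lead_coef_eq0 -size_poly_gt0.
pose B := \sum_(i < e.+1) `|p`_i|.
have B0 : 0 <= B by apply: sumr_ge0.
(* Chosen so that [|lead_coef p| * t] equals [|lead_coef p| + K + B], while the growth bound and the
   lower terms allow at most [K + B]. *)
pose t := 1 + (K + B) / `|lead_coef p|.
have t1 : 1 <= t by rewrite lerDl divr_ge0 ?addr_ge0 // ltW.
have t0 : 0 < t by apply: lt_le_trans t1.
have : `|lead_coef p| * t ^+ e.+1 <= (K + B) * t ^+ e.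
  have -> : lead_coef p = p`_e.+1 by rewrite lead_coefE Ee.
  rewrite -{1}(gtr0_norm t0) -normrX -normrM.
  have -> : p`_e.+1 * t ^+ e.+1 = p.[t] - \sum_(i < e.+1) p`_i * t ^+ i.
    by rewrite horner_coef Ee big_ord_recr /= addrAC subrr add0r.
  rewrite (le_trans (ler_normB _ _)) // mulrDl lerD //.
    by rewrite (le_trans (H _ t1)) // ler_wpM2l // ler_weXn2l.
  rewrite (le_trans (ler_norm_sum _ _ _)) // /B mulr_suml ler_sum // => i _.
  by rewrite normrM normrX (gtr0_norm t0) ler_wpM2l // ler_weXn2l // -ltnS.
rewrite exprS mulrA ler_pM2r ?exprn_gt0 // /t mulrDr mulr1 mulrC divfK ?gt_eqF //.
by rewrite gerDr => /le_lt_trans /(_ lp); rewrite ltxx.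
Qed.

Lemma norm_prod_le (I : finType) (Z : pred I) (f : I -> C) (K e : C) :
  0 <= K -> 0 <= e -> (forall i, `|f i| <= K) ->
  (forall i, Z i -> `|f i| <= K * e) ->
  `|\prod_i f i| <= K ^+ #|I| * e ^+ #|Z|.
Proof.
move=> K0 e0 H HZ; rewrite normr_prod.
apply: (@le_trans _ _ (\prod_i (K * (if Z i then e else 1)))).
  apply: ler_prod => i _; rewrite normr_ge0 /=.
  by case: ifP => [/HZ //|_]; rewrite mulr1.
by rewrite big_split /= prodr_const -big_mkcond prodr_const.
Qed.

End Growth.

(** * The product over all sign vectors: degree and vanishing order *)

Section SignedFactors.
Variables (C : numClosedFieldType) (n : nat) (c : C) (k a : 'I_n -> C).
Local Notation signs := {ffun 'I_n -> bool}.

Definition signed_factor (sg : signs) (t : C) (s : 'I_n -> C) : C :=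
  c * t - \sum_i (-1) ^+ sg i * k i * s i.

Definition flip_sign (i : 'I_n) (sg : signs) : signs :=
  [ffun j => sg j (+) (j == i)].

Lemma flip_signK i : involutive (flip_sign i).
Proof. by move=> sg; apply/ffunP => j; rewrite !ffunE -addbA addbb addbF. Qed.

Lemma factor_flip sg t s i :
  signed_factor sg t (flip i s) = signed_factor (flip_sign i sg) t s.
Proof.
congr (_ - _); apply: eq_bigr => j _; rewrite ffunE /flip signr_addb.
by case: eqP => _ /=; rewrite ?expr1 ?expr0; ring.
Qed.

Lemma factor_flip0 sg t s i : s i = 0 ->
  signed_factor (flip_sign i sg) t s = signed_factor sg t s.
Proof.
move=> si; congr (_ - _); apply: eq_bigr => j _; rewrite ffunE.
by case: (j =P i) => [->|_]; rewrite ?addbF // si !mulr0.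
Qed.

Lemma prod_factor_poly : exists P : {poly C},
  forall t s, radicals a t s -> \prod_sg signed_factor sg t s = P.[t].
Proof.
apply: (@flip_invariant_poly _ _ a n (fun t s => \prod_sg signed_factor sg t s)) => //.
  apply: polyfun_prod => sg; rewrite /signed_factor.
  apply: PolyfunExt (PolyfunAdd (PolyfunMul (PolyfunConst n n c) (PolyfunVar C n n))
    (@polyfun_sum C n n _ (index_enum _)
       (fun i _ s => - ((-1) ^+ sg i * k i) * s i) _)) _.
    move=> i; apply: PolyfunMul (PolyfunConst n n _) _.
    exact: PolyfunRadical.
  move=> t s /=; congr (_ + _); rewrite -sumrN; apply: eq_bigr => i _.
  by rewrite mulNr.
move=> t s i _; rewrite [RHS](reindex_inj (can_inj (flip_signK i))).
by apply: eq_bigr => sg _; rewrite factor_flip.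
Qed.

Lemma norm_factor_sub sg t s t0 s0 :
  `|signed_factor sg t s - signed_factor sg t0 s0| <=
  `|c| * `|t - t0| + \sum_i `|k i| * `|s i - s0 i|.
Proof.
have -> : signed_factor sg t s - signed_factor sg t0 s0 =
    c * (t - t0) - \sum_i (-1) ^+ sg i * k i * (s i - s0 i).
  rewrite /signed_factor; under [in RHS]eq_bigr do rewrite mulrBr.
  by rewrite sumrB; ring.
rewrite (le_trans (ler_normB _ _)) // normrM lerD2l.
rewrite (le_trans (ler_norm_sum _ _ _)) // ler_sum // => i _.
by rewrite !normrM normrX normrN1 expr1n mul1r.
Qed.

Lemma radicals_exist t : exists s, radicals a t s.
Proof. by exists (fun i => sqrtC (t - a i)) => i; rewrite sqrtCK. Qed.

(* Of the two square roots choose the one closer to [s0 i]: then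
   |s - s0|^2 <= |s - s0| |s + s0| = |t - t0| and |s0| <= |s + s0|. *)
Lemma radicals_near t0 s0 t : radicals a t0 s0 -> exists s,
  [/\ radicals a t s, forall i, `|s i - s0 i| ^+ 2 <= `|t - t0| &
      forall i, `|s0 i| * `|s i - s0 i| <= `|t - t0|].
Proof.
move=> V0.
pose r i := sqrtC (t - a i).
pose s i := if `|r i - s0 i| <= `|r i + s0 i| then r i else - r i.
have V : radicals a t s.
  by move=> i; rewrite /s; case: ifP => _; rewrite ?sqrrN sqrtCK.
have Ens i : `|s i - s0 i| <= `|s i + s0 i|.
  rewrite /s; case: ifP => // /negbT.
  rewrite -real_ltNge ?normr_real // => /ltW.
  by rewrite -[X in _ -> X <= _]normrN opprB opprK addrC -[X in _ -> _ <= X]normrN opprD opprK.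
have Es i : `|s i - s0 i| * `|s i + s0 i| = `|t - t0|.
  by rewrite -normrM -subr_sqr V V0; congr `|_|; ring.
exists s; split=> // i.
  by rewrite -(Es i) expr2 ler_wpM2l.
rewrite -(Es i) mulrC ler_wpM2l //.
have H : `|s0 i| *+ 2 <= `|s i + s0 i| + `|s i - s0 i|.
  rewrite -normrMn (_ : s0 i *+ 2 = (s i + s0 i) - (s i - s0 i)) ?ler_normB //.
  by ring.
have : `|s0 i| *+ 2 <= `|s i + s0 i| *+ 2.
  by rewrite (le_trans H) // mulr2n lerD2l.
by rewrite lerMn2r.
Qed.

(** After squaring, it is enough that [u^2 + |a i| <= u^2 (1 + |a i|)^2], which uses [u >= 1]. *)
Lemma radicals_growth u s i : 1 <= u -> radicals a (u ^+ 2) s ->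
  `|s i| <= u * (1 + `|a i|).
Proof.
move=> u1 V; have u0 : 0 <= u by apply: le_trans u1.
have U : 0 <= u * (1 + `|a i|) by rewrite mulr_ge0 ?addr_ge0.
rewrite -(@ler_pXn2r _ 2) ?nnegrE //.
rewrite -normrX V (le_trans (ler_normB _ _)) // normrX (ger0_norm u0).
rewrite exprMn sqrrD expr1n mul1r -addrA mulrDr mulr1 lerD2l.
rewrite (le_trans (_ : _ <= 1 * (`|a i| *+ 2 + `|a i| ^+ 2))) //.
  by rewrite mul1r mulr2n -addrA lerDl addr_ge0 ?exprn_ge0.
by rewrite ler_wpM2r ?expr_ge1 // addr_ge0 ?mulrn_wge0 ?exprn_ge0.
Qed.

Lemma norm_sum_radicals (sg : signs) u s : 1 <= u -> radicals a (u ^+ 2) s ->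
  `|\sum_i (-1) ^+ sg i * k i * s i| <= u * \sum_i `|k i| * (1 + `|a i|).
Proof.
move=> u1 V; rewrite (le_trans (ler_norm_sum _ _ _)) // mulr_sumr ler_sum // => i _.
rewrite !normrM normrX normrN1 expr1n mul1r mulrCA ler_wpM2l //.
exact: radicals_growth.
Qed.

Variable P : {poly C}.
Hypothesis prod_factor : forall t s, radicals a t s ->
  \prod_sg signed_factor sg t s = P.[t].

(** Each of the [2 ^ n] factors grows at most linearly in [t], since the radicals grow like its
    square root. *)
Lemma size_prod_factor : (size P <= (2 ^ n).+1)%N.
Proof.
pose S := \sum_i `|k i| * (1 + `|a i|).
have S0 : 0 <= S by apply: sumr_ge0 => i _; rewrite mulr_ge0 ?addr_ge0.
apply: (@size_poly_growth _ _ _ ((`|c| + S) ^+ (2 ^ n))).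
  by rewrite exprn_ge0 ?addr_ge0.
move=> t t1; have t0 : 0 <= t by apply: le_trans t1.
have [s V] := radicals_exist t.
rewrite -(prod_factor V) -exprMn normr_prod.
have -> : ((`|c| + S) * t) ^+ (2 ^ n) = \prod_(sg : signs) ((`|c| + S) * t).
  by rewrite prodr_const card_ffun card_bool card_ord.
apply: ler_prod => sg _; rewrite normr_ge0 /signed_factor.
rewrite (le_trans (ler_normB _ _)) // normrM (ger0_norm t0) mulrDl lerD2l.
have u1 : 1 <= sqrtC t by rewrite -sqrtC1 ler_sqrtC ?nnegrE.
rewrite -[t in radicals _ t]sqrtCK in V.
rewrite (le_trans (norm_sum_radicals _ u1 V)) // mulrC ler_wpM2l //.
by rewrite -[leRHS](sqrtCK t) expr2 ler_peMr // (le_trans _ u1).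
Qed.

(** At [t = u ^+ 2] the term [c * t] is quadratic in [u] and the radicals only linear, so no factor
    vanishes for large [u]. *)
Lemma prod_factor_neq0 : c != 0 -> P != 0.
Proof.
move=> c0; apply/eqP => P0.
have cp : 0 < `|c| by rewrite normr_gt0.
pose S := \sum_i `|k i| * (1 + `|a i|).
have S0 : 0 <= S by apply: sumr_ge0 => i _; rewrite mulr_ge0 ?addr_ge0.
(* Then [|c| * u = |c| + S], whereas a vanishing factor would give [|c| * u <= S]. *)
pose u := 1 + S / `|c|.
have u1 : 1 <= u by rewrite lerDl divr_ge0.
have u0 : 0 < u by apply: lt_le_trans u1.
have [s V] := radicals_exist (u ^+ 2).
have /eqP := prod_factor V; rewrite P0 horner0 => /prodf_eq0[sg _].
rewrite subr_eq0 => /eqP E.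
have := norm_sum_radicals sg u1 V; rewrite -E normrM normrX (gtr0_norm u0).
rewrite mulrC expr2 -mulrA ler_pM2l // -/S /u mulrDl mul1r divfK ?gt_eqF //.
by rewrite gerDr => /le_lt_trans /(_ cp); rewrite ltxx.
Qed.

(* If no radical vanishes at [t0], every vanishing signed_factor is O(e) at [t0 + e];
   otherwise it is only O(sqrt e), but each vanishing signed_factor is paired with
   the one obtained by flipping the sign of a vanishing radical. *)
Lemma card_factor_le_mup t0 s0 (A : {set signs}) : P != 0 -> radicals a t0 s0 ->
  (forall sg, sg \in A -> signed_factor sg t0 s0 = 0) ->
  (forall sg i, sg \in A -> s0 i = 0 -> sg i = false) ->
  (#|A| <= mup t0 P)%N.
Proof.
move=> P0 V0 HA A0.
rewrite mup_geq //.
pose Z := [pred sg | signed_factor sg t0 s0 == 0].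
(* [M] bounds every factor at [t0 + e] for [e <= 1], when each radical moves by at most 1. *)
pose M := \sum_sg `|signed_factor sg t0 s0| + (`|c| + \sum_i `|k i|).
have M0 : 0 <= M by rewrite !addr_ge0 ?sumr_ge0.
have Ee e : 0 < e -> `|t0 + e - t0| = e by move=> e0; rewrite addrC addKr gtr0_norm.
have HM e s sg : 0 < e -> e <= 1 ->
    (forall i, `|s i - s0 i| ^+ 2 <= e) -> `|signed_factor sg (t0 + e) s| <= M.
  move=> e0 e1 Hs.
  rewrite -[X in `|X|](subrK (signed_factor sg t0 s0)) addrC.
  rewrite (le_trans (ler_normD _ _)) // lerD //.
    by rewrite (bigD1 sg) //= lerDl sumr_ge0.
  rewrite (le_trans (norm_factor_sub _ _ _ _ _)) // Ee // lerD //.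
    by rewrite ler_piMr.
  apply: ler_sum => i _; rewrite ler_piMr // -(@expr_le1 _ 2) //.
  exact: le_trans (Hs i) e1.
case: (pickP (fun i => s0 i == 0)) => [j /eqP sj|nz]; last first.
  (* A Lipschitz constant: dividing by the nonzero [|s0 i|] makes the change of each radical linear
     in [e]. *)
  pose L := `|c| + \sum_i `|k i| / `|s0 i|.
  have L0 : 0 <= L by rewrite addr_ge0 // sumr_ge0 // => i _; rewrite divr_ge0.
  have ML0 : 0 <= M + L by exact: addr_ge0.
  apply: (@dvdp_XsubC_exp _ _ _ _ ((M + L) ^+ #|{: signs}|)).
    by rewrite exprn_ge0.
  move=> e e0 e1; have [s [V H2 H1]] := radicals_near (t0 + e) V0.
  rewrite Ee // in H2 H1.
  rewrite -(prod_factor V).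
  apply: (@le_trans _ _ ((M + L) ^+ #|{: signs}| * e ^+ #|Z|)).
    apply: norm_prod_le => //; first exact: ltW; move=> sg.
      by rewrite (le_trans (HM _ _ _ e0 e1 H2)) // lerDl.
    move=> /eqP fz; rewrite -[signed_factor _ _ _]subr0 -[X in _ - X]fz.
    rewrite (le_trans (norm_factor_sub _ _ _ _ _)) // Ee //.
    rewrite (le_trans (_ : _ <= L * e)) //; last first.
      by rewrite ler_wpM2r ?(ltW e0) // lerDr.
    rewrite mulrDl lerD2l mulr_suml ler_sum // => i _.
    rewrite -mulrA ler_wpM2l // ler_pdivlMl ?H1 // normr_gt0.
    by rewrite nz.
  rewrite ler_wpM2l ?exprn_ge0 //.
  rewrite ler_wiXn2l ?(ltW e0) //; apply: subset_leq_card.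
  by apply/fintype.subsetP => sg sgA; rewrite inE HA.
(* By [A0] all members of [A] are false at [j], so flipping there gives a disjoint copy of [A]; its
   factors vanish too because [s0 j = 0]. *)
have cardZ : (2 * #|A| <= #|Z|)%N.
  have -> : (2 * #|A| = #|A :|: flip_sign j @: A|)%N.
    rewrite cardsU [X in (_ - X)%N](_ : _ = 0)%N ?subn0.
      by rewrite card_imset ?mul2n ?addnn //; exact: can_inj (flip_signK j).
    apply: eq_card0 => sg; rewrite !inE; apply/negP => /andP[sA /imsetP[sg' sA' E]].
    have := A0 _ _ sA sj; rewrite E ffunE eqxx.
    by rewrite (A0 _ _ sA' sj).
  apply: subset_leq_card; apply/fintype.subsetP => sg; rewrite !inE.
  case/orP => [/HA -> //|/imsetP[sg' sA ->]].
  by rewrite factor_flip0 // HA.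
pose L := `|c| + \sum_i `|k i|.
have L0 : 0 <= L by rewrite addr_ge0 // sumr_ge0.
have ML0 : 0 <= M + L by exact: addr_ge0.
apply: (@dvdp_XsubC_exp _ _ _ _ ((M + L) ^+ #|{: signs}|)).
  by rewrite exprn_ge0.
move=> e e0 e1; have [s [V H2 _]] := radicals_near (t0 + e) V0.
rewrite Ee // in H2.
rewrite -(prod_factor V).
have h0 : 0 <= sqrtC e by rewrite sqrtC_ge0 ltW.
have h1 : sqrtC e <= 1 by rewrite -sqrtC1 ler_sqrtC ?nnegrE // ltW.
apply: (@le_trans _ _ ((M + L) ^+ #|{: signs}| * (sqrtC e) ^+ #|Z|)).
  apply: norm_prod_le => // sg.
    by rewrite (le_trans (HM _ _ _ e0 e1 H2)) // lerDl.
  move=> /eqP fz; rewrite -[signed_factor _ _ _]subr0 -[X in _ - X]fz.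
  rewrite (le_trans (norm_factor_sub _ _ _ _ _)) // Ee //.
  rewrite (le_trans (_ : _ <= L * sqrtC e)) //; last first.
    by rewrite ler_wpM2r // lerDr.
  rewrite mulrDl lerD //.
    by rewrite ler_wpM2l // -[leLHS]sqrtCK expr2 ler_piMr.
  rewrite mulr_suml ler_sum // => i _; rewrite ler_wpM2l //.
  by rewrite -(@ler_pXn2r _ 2) ?nnegrE // sqrtCK.
rewrite ler_wpM2l ?exprn_ge0 //.
(* At least [2 * #|A|] factors of size O(sqrt e) yield [e ^+ #|A|]. *)
rewrite -[e in leRHS]sqrtCK -exprM.
by rewrite ler_wiXn2l.
Qed.

End SignedFactors.

(** * Counting pairs of a root and a sign vector with multiplicity *)

Lemma count_fst_le_mup (C : numClosedFieldType) (n : nat) (c : C)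
    (k a : 'I_n -> C) (P : {poly C}) (rt : C -> 'I_n -> C)
    (zs : seq (C * {ffun 'I_n -> bool})) (x : C) :
  (forall t s, radicals a t s -> \prod_sg signed_factor c k sg t s = P.[t]) ->
  P != 0 -> uniq zs ->
  (forall t sg, (t, sg) \in zs ->
     [/\ radicals a t (rt t), signed_factor c k sg t (rt t) = 0 &
         forall i, rt t i = 0 -> sg i = false]) ->
  (count_mem x [seq p.1 | p <- zs] <= mup x P)%N.
Proof.
move=> HP P0 uzs Hz.
(* Pairs sharing the first component [x] have distinct sign vectors, so the count is the size of a
   set of sign vectors. *)
pose l := [seq p.2 | p <- zs & p.1 == x].
have memA sg : (sg \in l) = ((x, sg) \in zs).
  apply/mapP/idP => [[[t sg'] /= + ->]|h].
    by rewrite mem_filter /= => /andP[/eqP ->].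
  by exists (x, sg); rewrite // mem_filter /= eqxx.
have ul : uniq l.
  rewrite map_inj_in_uniq ?filter_uniq // => -[t sg] [t' sg'].
  by rewrite !mem_filter /= => /andP[/eqP -> _] /andP[/eqP -> _] /= ->.
have -> : count_mem x [seq p.1 | p <- zs] = #|[set sg in l]|.
  by rewrite cardsE (card_uniqP ul) size_map size_filter count_map.
have [l0|[sg0 Hsg0]] := set_0Vmem [set sg in l]; first by rewrite l0 cards0.
move: Hsg0; rewrite inE memA => /Hz[V _ _].
apply: (card_factor_le_mup HP P0 V) => [sg|sg i].
  by rewrite inE memA => /Hz[].
by rewrite inE memA => /Hz[_ _]; apply.
Qed.

(* The sign vectors [sg = 0] and [sg = (z_i <> 0)] both vanish at t = 0, so 0 is
   a spurious root of multiplicity at least 2. *)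
Lemma size_signed_zeros (C : numClosedFieldType) (n : nat) (c : C)
    (k a z : 'I_n -> C) (rt : C -> 'I_n -> C)
    (zs : seq (C * {ffun 'I_n -> bool})) (j : 'I_n) :
  c != 0 -> radicals a 0 z -> z j != 0 -> \sum_i k i * z i = 0 ->
  uniq zs ->
  (forall t sg, (t, sg) \in zs ->
     [/\ t != 0, radicals a t (rt t), signed_factor c k sg t (rt t) = 0 &
         forall i, rt t i = 0 -> sg i = false]) ->
  (size zs + 2 <= 2 ^ n)%N.
Proof.
move=> c0 Vz zj Sz uzs Hz.
have [P HP] := prod_factor_poly c k a.
have P0 := prod_factor_neq0 HP c0.
have mup0 : (2 <= mup 0 P)%N.
  pose s0 : {ffun 'I_n -> bool} := [ffun => false].
  pose s1 : {ffun 'I_n -> bool} := [ffun i => z i != 0].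
  have -> : 2%N = #|[set s0; s1]|.
    rewrite cards2; case: eqP => // /ffunP/(_ j).
    by rewrite !ffunE zj.
  apply: (card_factor_le_mup HP P0 Vz) => sg.
    case/set2P => ->; rewrite /signed_factor mulr0 sub0r.
      under eq_bigr do rewrite ffunE mul1r.
      by rewrite Sz oppr0.
    under eq_bigr => i _.
      have -> : (-1) ^+ s1 i * k i * z i = - (k i * z i).
        rewrite ffunE; have [->|_] := eqVneq (z i) 0; first by rewrite !mulr0 oppr0.
        by rewrite mulN1r mulNr.
      over.
    by rewrite sumrN Sz !oppr0.
  by move=> i /set2P[->|->] zi; rewrite ffunE // zi eqxx.
have [rs Ers] := closed_field_poly_normal P.
have mupE x : mup x P = count_mem x rs.
  by rewrite Ers -mul_polyC mupMr ?mu_prod_XsubC // rootC lead_coef_eq0.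
have szrs : (size rs <= 2 ^ n)%N.
  have := size_prod_factor HP.
  by rewrite Ers size_scale ?lead_coef_eq0 // size_prod_XsubC.
apply: leq_trans szrs.
(* Two copies of 0 and all values [t] form a sub-multiset of the roots of [P]; as the values [t] are
   nonzero, they do not compete with 0 for multiplicity. *)
have /count_subseqP[u ur pu] : forall x : C,
    (count_mem x [:: 0%R, 0%R & [seq p.1 | p <- zs]] <= count_mem x rs)%N.
  move=> x; rewrite -mupE /=; have [->|_] := eqVneq x 0.
    rewrite [X in (_ + (_ + X) <= _)%N](_ : _ = 0%N) //.
    apply/eqP; rewrite -leqn0 leqNgt -has_count has_map; apply/hasP => -[[t sg] /Hz[]].
    by move=> /= /negbTE ->.
  rewrite !add0n.
  by apply: (count_fst_le_mup (rt := rt) x HP P0 uzs) => t sg /Hz[].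
have := size_subseq ur; rewrite -(perm_size pu) /= size_map.
by rewrite addn2.
Qed.

(** * Recovering an equilibrium from its order parameter and cosine signs *)

Lemma cos_sin_inj (R : realType) (x y : R) :
  - pi < x <= pi -> - pi < y <= pi -> cos x = cos y -> sin x = sin y -> x = y.
Proof.
move=> /andP[x1 x2] /andP[y1 y2] cxy sxy.
have bnd (u : R) : - pi < u -> u <= pi -> `|u| \in `[0, pi].
  by move=> u1 u2; rewrite in_itv /= normr_ge0 ler_norml (ltW u1).
have cos_norm (u : R) : cos `|u| = cos u.
  by case: (ler0P u) => _; rewrite ?cosN.
have E : `|x| = `|y|.
  by apply: cos_inj; rewrite ?bnd // !cos_norm.
have [//|yx] : x = y \/ y = - x.
  by move/eqP: E; rewrite eqr_norm2 => /orP[/eqP ->|/eqP ->]; rewrite ?opprK; auto.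
have sx : sin x = 0 by move/eqP: sxy; rewrite yx sinN eq_sym eqNr => /eqP.
(* Only the pair [pi], [- pi] could be an exception; the open end at [- pi], for both angles,
   excludes it. *)
have [x0|x0|x0] := ltgtP x 0; last by rewrite yx x0 oppr0.
  have : 0 < sin (- x) by apply: sin_gt0_pi; rewrite oppr_gt0 x0 /=; lra.
  by rewrite sinN sx oppr0 ltxx.
have : 0 < sin x by apply: sin_gt0_pi; rewrite x0 /=; lra.
by rewrite sx ltxx.
Qed.

Section Equilibria.
Variables (R : realType) (n : nat) (omega k : 'I_n -> R).
Hypotheses (hn : (0 < n)%N) (hk : forall i, 0 < k i).
Hypothesis homega : exists i, omega i != 0.

(** The Kuramoto order parameter: the normalization makes the mean of [k_i e^{i theta_i}] real, so
    its real part suffices. *)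
Definition order_parameter (theta : {ffun 'I_n -> R}) : R :=
  n%:R^-1 * \sum_i k i * cos (theta i).

(** A zero cosine is recorded as [false], matching the convention that a vanishing radical carries
    the sign [false]. *)
Definition cos_sign (theta : {ffun 'I_n -> R}) : {ffun 'I_n -> bool} :=
  [ffun i => cos (theta i) < 0].

Lemma equilibrium_sin theta i : is_equilibrium omega k theta ->
  omega i / k i = order_parameter theta * sin (theta i).
Proof.
move=> [_ [/(_ i) -> [S0 _]]].
(* The addition formula separates [theta i] from the sums; the sine sum is zero by the
   normalization. *)
have -> : \sum_(mu < n) k i * k mu * sin (theta i - theta mu) =
    k i * (sin (theta i) * (\sum_mu k mu * cos (theta mu)) -
           cos (theta i) * (\sum_mu k mu * sin (theta mu))).
  rewrite !mulr_sumr -sumrB mulr_sumr; apply: eq_bigr => mu _.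
  by rewrite sinB; ring.
rewrite S0 /order_parameter.
field.
by rewrite pnatr_eq0 -lt0n hn gt_eqF.
Qed.

(** At the value 0, [equilibrium_sin] would force all of [omega] to vanish. *)
Lemma order_parameter_gt0 theta : is_equilibrium omega k theta ->
  0 < order_parameter theta.
Proof.
move=> eqm; have [_ [_ [_ S0]]] := eqm.
rewrite lt_neqAle mulr_ge0 ?invr_ge0 ?ler0n // andbT eq_sym; apply/eqP => r0.
have [i wi] := homega; have := equilibrium_sin i eqm; rewrite r0 mul0r.
by move/eqP; rewrite mulf_eq0 invr_eq0 (gt_eqF (hk i)) orbF (negbTE wi).
Qed.

Lemma equilibrium_cos theta i : is_equilibrium omega k theta ->
  Num.sqrt (order_parameter theta ^+ 2 - (omega i / k i) ^+ 2) =
  order_parameter theta * `|cos (theta i)|.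
Proof.
move=> eqm; rewrite (equilibrium_sin i eqm).
have -> : order_parameter theta ^+ 2 - (order_parameter theta * sin (theta i)) ^+ 2 =
   (order_parameter theta * cos (theta i)) ^+ 2.
  by rewrite !exprMn cos2sin2; ring.
by rewrite sqrtr_sqr normrM gtr0_norm // order_parameter_gt0.
Qed.

(** [omega i / k i] fixes the sine, the radical fixes the absolute cosine and the sign bit restores
    the cosine. *)
Lemma equilibrium_inj theta theta' :
  is_equilibrium omega k theta -> is_equilibrium omega k theta' ->
  order_parameter theta ^+ 2 = order_parameter theta' ^+ 2 ->
  cos_sign theta = cos_sign theta' -> theta = theta'.
Proof.
move=> eqm eqm' r2 sg.
have r0 := order_parameter_gt0 eqm; have r0' := order_parameter_gt0 eqm'.
have r : order_parameter theta = order_parameter theta'.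
  by apply/eqP; rewrite -(@eqrXn2 _ 2) ?ltW //; apply/eqP.
have rn0 : order_parameter theta' != 0 by rewrite gt_eqF.
apply/ffunP => i; apply: cos_sin_inj; [exact: eqm.1|exact: eqm'.1| |].
  rewrite -[LHS]mulr_sign_norm -[RHS]mulr_sign_norm.
  move/ffunP/(_ i): sg; rewrite !ffunE => ->; congr (_ * _).
  by apply: (mulfI rn0); rewrite -{1}r -!equilibrium_cos ?r.
by apply: (mulfI rn0); rewrite -{1}r -!equilibrium_sin.
Qed.

End Equilibria.

(** * Encoding equilibria as signed zeros over the complex numbers *)

Theorem theorem3 (R : realType) (n : nat) (omega k : 'I_n -> R)
  (hn : (2 <= n)%N)
  (hk : forall mu : 'I_n, 0 < k mu)
  (IC1 : \sum_(mu < n) omega mu = 0)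
  (IC2 : exists mu : 'I_n, omega mu != 0)
  (IC3 : forall mu nu : 'I_n, (mu <= nu)%N ->
           `|omega mu / k mu| <= `|omega nu / k nu|) :
  forall s : seq {ffun 'I_n -> R}, uniq s ->
    (forall theta, theta \in s -> is_equilibrium omega k theta) ->
    (size s <= 2 ^ n - 2)%N.
Proof.
move=> s us Hs; have n0 : (0 < n)%N by apply: ltnW.
have [j wj] := IC2.
pose r := order_parameter k.
(* [Num.sqrt] is 0 on negative reals, but at an equilibrium its argument is the square of
   [r theta * cos (theta i)]. *)
pose rt (t : R[i]) i := real_complex R (Num.sqrt (complex.Re t - (omega i / k i) ^+ 2)).
pose zs := [seq (real_complex R (r theta ^+ 2), cos_sign theta) | theta <- s].
(* The truncated subtraction is exact because [2 <= 2 ^ n]. *)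
rewrite -(@leq_add2r 2) subnK; last by rewrite (@leq_pexp2l 2 1).
have <- : size zs = size s by rewrite size_map.
apply: (@size_signed_zeros _ _ n%:R (fun i => real_complex R (k i))
   (fun i => real_complex R ((omega i / k i) ^+ 2))
   (fun i => Complex 0 (omega i / k i)) rt zs j).
- by rewrite pnatr_eq0 -lt0n.
- move=> i; rewrite expr2; apply/eqP; rewrite eq_complex /=.
  by apply/andP; split; apply/eqP; ring.
- rewrite eq_complex /= negb_and; apply/orP; right.
  by rewrite mulf_neq0 // invr_eq0 gt_eqF.
- rewrite (eq_bigr (fun i => Complex 0 1 * real_complex R (omega i))); last first.
    move=> i _; apply/eqP; rewrite eq_complex /=; apply/andP; split; apply/eqP; first by ring.
    by field; rewrite gt_eqF.
  by rewrite -mulr_sumr -rmorph_sum IC1 rmorph0 mulr0.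
- rewrite map_inj_in_uniq // => th th' /Hs eqm /Hs eqm' [r2].
  exact: (equilibrium_inj n0 hk IC2 eqm eqm' r2).
move=> t sg /mapP[theta /Hs eqm [-> ->]].
have rp : 0 < r theta := order_parameter_gt0 n0 hk IC2 eqm.
have rtE i : rt (real_complex R (r theta ^+ 2)) i =
    real_complex R (r theta * `|cos (theta i)|).
  by rewrite /rt /= (equilibrium_cos n0 hk IC2 i eqm).
split.
- by rewrite fmorph_eq0 expf_eq0 /= gt_eqF.
- move=> i; rewrite rtE -rmorphXn -rmorphB; congr (real_complex R _).
  rewrite (equilibrium_sin n0 hk i eqm) -/(r theta) [LHS]exprMn.
  by rewrite real_normK ?num_real // cos2sin2; ring.
(* The sign bits turn absolute cosines back into cosines, so the signed sum is [n * r theta ^+ 2] by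
   definition of [r]. *)
- rewrite /signed_factor (eq_bigr (fun i => real_complex R (r theta * (k i * cos (theta i))))).
    rewrite -rmorph_sum -mulr_sumr -[n%:R](rmorph_nat (real_complex R)) -rmorphM -rmorphB.
    apply/eqP; rewrite fmorph_eq0 subr_eq0 /r /order_parameter; apply/eqP; field.
    by rewrite pnatr_eq0 -lt0n.
  move=> i _; rewrite rtE ffunE -[in RHS](mulr_sign_norm (cos (theta i))).
  by rewrite -(rmorph_sign (real_complex R)) -!rmorphM; congr (real_complex R _); ring.
- move=> i; rewrite rtE => /eqP; rewrite fmorph_eq0 mulf_eq0 gt_eqF //= normr_eq0.
  by rewrite ffunE => /eqP ->; rewrite ltxx.
Qed.
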